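(* For all integers $n$, $r$ and $k$ with $n\ge r\ge 1$, $$\sum_{j=r}^n\left\{{n\atop j}\right\}_r\widehat c_j^{(k)}=\sum_{\ell=1}^{r}\frac{(-1)^{n}}{(n-r+\ell+1)^k}\left[{r\atop \ell}\right].$$
   Context: For an integer $k$, the poly-Cauchy numbers of the second kind $\widehat c_n^{(k)}$ are defined by $\mathrm{Lif}_k(-\log(1+x))=\sum_{n\ge0}\widehat c_n^{(k)}x^n/n!$, where $\mathrm{Lif}_k(z)=\sum_{m\ge0}\frac{z^m}{m!(m+1)^k}$. $\left[{n\atop m}\right]$ denotes the unsigned Stirling number of the first kind, defined by $x(x+1)\cdots(x+n-1)=\sum_{m}\left[{n\atop m}\right]x^m$. For $r\ge 0$, the $r$-Stirling number of the second kind $\left\{{n\atop m}\right\}_r$ is the number of ways to partition $\{1,\dots,n\}$ into $m$ nonempty disjoint blocks such that $1,\dots,r$ lie in distinct blocks; equivalently $\left\{{n\atop m}\right\}_r=0$ for $n<r$, $\left\{{r\atop m}\right\}_r=\delta_{m,r}$, and $\left\{{n\atop m}\right\}_r=m\left\{{n-1\atop m}\right\}_r+\left\{{n-1\atop m-1}\right\}_r$ for $n>r$. *)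

(* Defs.v *)
From HB Require Import structures.
From mathcomp Require Import all_boot all_order all_algebra.
Set Implicit Arguments.
Unset Strict Implicit.
Unset Printing Implicit Defensive.
Import Order.TTheory GRing.Theory Num.Theory.
Local Open Scope ring_scope.

(* A formal power series over [rat] is its coefficient sequence [nat -> rat]. *)

Definition fps_one : nat -> rat := fun n => (n == 0%N)%:R.

Definition fps_mul (f g : nat -> rat) : nat -> rat :=
  fun n => \sum_(i < n.+1) f i * g (n - i)%N.

Definition fps_exp (f : nat -> rat) (m : nat) : nat -> rat :=
  iter m (fps_mul f) fps_one.

(* The composite [f (g (x))], meaningful when [g 0 = 0]: then the powers [g ^ m]
   with [m > n] do not contribute to the coefficient of [x ^ n]. *)
Definition fps_comp (f g : nat -> rat) : nat -> rat :=
  fun n => \sum_(m < n.+1) f m * fps_exp g m n.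

(* log (1 + x) = \sum_(n >= 1) (-1)^(n-1) x^n / n *)
Definition fps_log1p : nat -> rat :=
  fun n => if n is p.+1 then (-1) ^+ p / p.+1%:R else 0.

Definition fps_Lif (k : int) : nat -> rat :=
  fun m => (m`!%:R * (m + 1)%:R ^ k)^-1.

(* n! times the coefficient of [x ^ n] in [Lif_k (- log (1 + x))]. *)
Definition polyCauchy2 (k : int) (n : nat) : rat :=
  n`!%:R * fps_comp (fps_Lif k) (fun i => - fps_log1p i) n.

Definition stirling1 (n m : nat) : nat :=
  ((\prod_(i < n) ('X + (i : nat)%:P) : {poly nat})`_m)%R.

(* The elements 1, ..., r of {1, ..., n} are the ordinals [i < r] of ['I_n].
   The conjunct [r <= n] makes the number 0 for n < r, when 1, ..., r do not
   all belong to the ground set. *)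
Definition rstirling2 (r n m : nat) : nat :=
  #|[set P : {set {set 'I_n}} |
      [&& (r <= n)%N, partition P [set: 'I_n], #|P| == m &
       [forall i : 'I_n, forall j : 'I_n,
          [&& (i < r)%N, (j < r)%N & i != j] ==> (pblock P i != pblock P j)]]]|.

(* Main.v *)
Require Import Defs.
From mathcomp Require Import all_boot all_order all_algebra ring.
Set Implicit Arguments.
Unset Strict Implicit.
Unset Printing Implicit Defensive.
Import Order.TTheory GRing.Theory Num.Theory.

(** Counting the maps ['I_n -> 'I_x] that are injective on the first [r] points
    according to their kernel gives
    [\sum_j {n, j}_r * x^_j = x^_r * x^(n - r)] in falling factorials. Substituting
    [- X] turns it into the polynomial identity
    [\sum_j {n, j}_r * (-1)^j * X^(j) = (-1)^n * X^(r) * X^(n - r)], where [X^(j)] is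
    the rising factorial. As [n! [x^n] (- log (1 + x))^m / m! = (-1)^n [n, m]], the
    number [polyCauchy2 k j] is the image of [(-1)^j * X^(j)] under the linear
    functional [X^m |-> 1 / (m + 1)^k]; the theorem is the image of the identity. *)

(** * Maps with a prescribed kernel *)

Section KernelCounting.
Variables (T R : finType).
Implicit Types (f : {ffun T -> R}) (P : {set {set T}}).

Lemma eq_pblock_ker f i j :
  (pblock (preim_partition f [set: T]) i == pblock (preim_partition f [set: T]) j)
  = (f i == f j).
Proof.
have tP := partition_trivIset (preim_partitionP f [set: T]).
have cP := cover_partition (preim_partitionP f [set: T]).
rewrite eq_pblock ?cP ?inE //.
rewrite pblock_equivalence_partition ?inE //.
by split=> // /eqP->.
Qed.

Lemma preim_partition_eq f P : partition P [set: T] ->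
  (preim_partition f [set: T] == P) =
  [forall i, forall j, (f i == f j) == (pblock P i == pblock P j)].
Proof.
move=> pP; apply/eqP/'forall_'forall_eqP=> [<- i j|fP]; first by rewrite eq_pblock_ker.
rewrite -(preim_partition_pblock pP).
by apply: eq_in_imset => x _; apply/setP=> y; rewrite !inE fP.
Qed.

Lemma leq_card_partition P : partition P [set: T] -> #|P| <= #|T|.
Proof.
move=> pP; rewrite -[X in _ <= X]cardsT (card_partition pP) -sum1_card.
apply: leq_sum => B BP; rewrite card_gt0.
by apply: contraTneq BP => ->; rewrite (partition0 pP).
Qed.

(** Such an [f] is constant on each block and separates distinct blocks, so it is [pblock P]
    followed by an injection of the set of blocks into [R]. *)
Lemma card_preim_partition P : partition P [set: T] ->
  #|[set f : {ffun T -> R} | preim_partition f [set: T] == P]| = #|R| ^_ #|P|.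
Proof.
move=> pP; have tP := partition_trivIset pP; have cP := cover_partition pP.
have bP i : pblock P i \in P by rewrite pblock_mem // cP inE.
pose U := {B | B \in P}.
pose b i : U := Sub (pblock P i) (bP i).
(* A representative of each block shows [b] surjective; this makes [F] injective and lets every [f]
   with kernel [P] factor through [b]. *)
have bs (B : U) : {i | b i = B}.
  have /set0Pn/sigW[x xB] : val B != set0.
    by apply: contraTneq (valP B) => /= ->; rewrite (partition0 pP).
  by exists x; apply: val_inj; rewrite /= (def_pblock tP (valP B) xB).
have bE i j : (b i == b j) = (pblock P i == pblock P j) by rewrite -val_eqE.
pose F (g : {ffun U -> R}) := [ffun i => g (b i)].
have injF : injective F.
  move=> g h /ffunP gh; apply/ffunP=> B; have [i <-] := bs B.
  by have := gh i; rewrite !ffunE.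
have <- : #|{: U}| = #|P| by rewrite card_sig.
rewrite -card_inj_ffuns -(card_imset _ injF).
apply: eq_card=> f; rewrite inE preim_partition_eq //.
apply/idP/imsetP=> [/'forall_'forall_eqP fP|[g]].
  exists [ffun B => f (tag (bs B))].
    rewrite inE; apply/injectiveP => B C; rewrite !ffunE => /eqP.
    by rewrite fP -bE (tagged (bs B)) (tagged (bs C)) => /eqP.
  apply/ffunP=> i; rewrite !ffunE; apply/eqP; rewrite fP -bE.
  by case: (bs (b i)) => j /= ->.
rewrite inE => /injectiveP gi ->; apply/'forall_'forall_eqP => i j.
by rewrite !ffunE (inj_eq gi) bE.
Qed.

End KernelCounting.

(** * Maps injective on the first [r] points *)

Lemma card_ffun_inj_lshift r d (R : finType) :
  #|[set f : {ffun 'I_(r + d) -> R} | injectiveb (f \o @lshift r d)]|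
  = #|R| ^_ r * #|R| ^ d.
Proof.
pose F (p : {ffun 'I_r -> R} * {ffun 'I_d -> R}) : {ffun 'I_(r + d) -> R} :=
  [ffun i => match split i with inl a => p.1 a | inr b => p.2 b end].
have Fl p a : F p (lshift d a) = p.1 a by rewrite ffunE (unsplitK (inl a)).
have Fr p b : F p (rshift r b) = p.2 b by rewrite ffunE (unsplitK (inr b)).
have injF : injective F.
  move=> [p1 p2] [q1 q2] /ffunP pq; congr pair; apply/ffunP=> i.
    by have := pq (lshift d i); rewrite !Fl.
  by have := pq (rshift r i); rewrite !Fr.
rewrite -[in RHS](card_ord r) -[in X in _ * X](card_ord d).
rewrite -card_inj_ffuns -card_ffun -cardsT -cardsX -(card_imset _ injF).
apply: eq_card => f; rewrite inE; apply/injectiveP/imsetP => [fi|[p]].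
  exists ([ffun a => f (lshift d a)], [ffun b => f (rshift r b)]).
    rewrite !inE /= andbT; apply/injectiveP => a a'.
    by rewrite !ffunE => /fi.
  by apply/ffunP=> i; rewrite -(splitK i); case: (split i) => j /=;
    rewrite ?Fl ?Fr ffunE.
rewrite !inE andbT => /injectiveP pi -> a a'.
by rewrite /= !Fl => /pi.
Qed.

(** [pblock P] is injective on the first [r] points, so [P] has at least [r] blocks. *)
Lemma rstirling2_lt r n j : j < r -> rstirling2 r n j = 0.
Proof.
move=> lt_jr; apply/eqP; rewrite cards_eq0 -subset0; apply/subsetP=> P.
rewrite inE => /and4P[le_rn pP /eqP cardP /forallP injP].
suff: r <= #|P| by rewrite cardP leqNgt lt_jr.
rewrite -[r]card_ord -(card_codom (f := pblock P \o widen_ord le_rn)).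
  apply/subset_leq_card/subsetP=> _ /codomP[i ->] /=.
  by rewrite pblock_mem // (cover_partition pP) inE.
move=> i i' /= eq_ii'; apply/val_inj/eqP/negPn/negP => /= ne_ii'.
have /forallP/(_ (widen_ord le_rn i')) := injP (widen_ord le_rn i).
by rewrite eq_ii' eqxx implybF /= !ltn_ord negbK -val_eqE /= (negPf ne_ii').
Qed.

(** Both sides count the maps into ['I_x] injective on the first [r] points; the left side groups
    them by kernel, and the kernels by number of blocks. *)
Lemma sum_rstirling2_ffact r d x :
  \sum_(j < (r + d).+1) rstirling2 r (r + d) j * x ^_ j = x ^_ r * x ^ d.
Proof.
pose sep (P : {set {set 'I_(r + d)}}) := [forall i : 'I_(r + d),
  forall j : 'I_(r + d),
    [&& i < r, j < r & i != j] ==> (pblock P i != pblock P j)].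
pose good P := partition P [set: 'I_(r + d)] && sep P.
(* Injectivity on the first [r] points depends on the kernel alone. *)
have sepE (f : {ffun 'I_(r + d) -> 'I_x}) :
    injectiveb (f \o @lshift r d) = good (preim_partition f setT).
  rewrite /good preim_partitionP /=.
  apply/injectiveP/'forall_'forall_implyP => [fi i j /and3P[ir jr]|fi a b /= fab].
    apply: contra_neq => /eqP; rewrite eq_pblock_ker => /eqP fij.
    have /(congr1 val)/= ij : Ordinal ir = Ordinal jr.
      apply: fi => /=.
      have -> : lshift d (Ordinal ir) = i by apply: val_inj.
      by have -> : lshift d (Ordinal jr) = j by apply: val_inj.
    exact: val_inj.
  apply/eqP/negPn/negP => ab.
  have := fi (lshift d a) (lshift d b).
  by rewrite /= !ltn_ord eq_pblock_ker fab eqxx (inj_eq (@lshift_inj _ _)) ab => /(_ isT).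
have := card_ffun_inj_lshift r d 'I_x; rewrite card_ord => <-.
rewrite -sum1dep_card.
rewrite (partition_big (fun f : {ffun _ -> _} => preim_partition f setT) good) /=; last first.
  by move=> f; rewrite sepE.
transitivity (\sum_(P | good P) x ^_ #|P|); last first.
  apply: eq_bigr => P gP; rewrite -{1}[x]card_ord -card_preim_partition; last first.
    by case/andP: gP.
  rewrite -sum1dep_card; apply: eq_bigl => f; rewrite sepE andbC.
  by case: eqP => // ->; rewrite gP.
(* [inord] loses nothing, as a partition has at most [r + d] blocks. *)
rewrite (partition_big (fun P : {set {set 'I_(r + d)}} => inord #|P| : 'I_(r + d).+1) xpredT) //=.
apply: eq_bigr => j _; rewrite /rstirling2 -sum1dep_card big_distrl /=.
apply: congr_big => // [P|P]; rewrite leq_addr /=; last first.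
  by case/and3P=> _ /eqP-> _; rewrite mul1n.
rewrite /good -andbA; case: (boolP (partition P _)) => //= pP.
rewrite andbC; congr (_ && _); rewrite -[RHS]val_eqE /= inordK // ltnS.
by have := leq_card_partition pP; rewrite card_ord.
Qed.

(** * Rising factorials as polynomials *)

Local Open Scope ring_scope.

(** Coefficients are in [rat], unlike in [stirling1], to allow evaluation at negative integers. *)
Definition rising_poly n : {poly rat} := \prod_(i < n) ('X + (i : nat)%:R%:P).

Lemma coef_rising_poly n m : (rising_poly n)`_m = (stirling1 n m)%:R.
Proof.
have -> : rising_poly n = map_poly (GRing.natmul 1)
    (\prod_(i < n) ('X + (i : nat)%:P) : {poly nat}).
  rewrite rmorph_prod; apply: eq_bigr => i _.
  by rewrite rmorphD /= map_polyX map_polyC.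
by rewrite coef_map.
Qed.

Lemma rising_polyS n : rising_poly n.+1 = rising_poly n * ('X + n%:R%:P).
Proof. by rewrite /rising_poly big_ord_recr. Qed.

Lemma coef_rising_polyS n m : (rising_poly n.+1)`_m.+1 =
  (rising_poly n)`_m + n%:R * (rising_poly n)`_m.+1.
Proof. by rewrite rising_polyS mulrDr coefD coefMX coefMC mulrC. Qed.

Lemma coef0_rising_polyS n : (rising_poly n.+1)`_0 = 0.
Proof.
by rewrite /rising_poly big_ord_recl addr0 coefXM.
Qed.

Lemma coef_rising_poly_gt n m : (n < m)%N -> (rising_poly n)`_m = 0.
Proof.
elim: n m => [|n IHn] [|m] // lt_nm.
  by rewrite /rising_poly big_ord0 coef1.
by rewrite coef_rising_polyS !IHn ?mulr0 ?addr0 // ltnW.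
Qed.

Lemma horner_rising_polyN n x : (rising_poly n).[- x%:R] = (-1) ^+ n * (x ^_ n)%:R.
Proof.
elim: n => [|n IHn]; first by rewrite /rising_poly big_ord0 hornerC ffactn0 mul1r.
rewrite rising_polyS hornerM IHn hornerD hornerX hornerC ffactnSr natrM.
(* The truncated [x - n] is the true difference only for [n <= x]; otherwise [x ^_ n = 0]
   annihilates both sides. *)
have [le_nx|lt_xn] := leqP n x; last by rewrite ffact_small // !(mulr0, mul0r).
rewrite natrB // exprS; ring.
Qed.

Lemma sum_rstirling2_rising_poly r d :
  \sum_(j < (r + d).+1)
    ((rstirling2 r (r + d) j)%:R * (-1) ^+ j) *: rising_poly j
  = (-1) ^+ (r + d) *: (rising_poly r * 'X^d).
Proof.
apply/eqP; rewrite -subr_eq0; apply/eqP; set p := _ - _.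
(* A nonzero polynomial has fewer roots than its size, while [p] vanishes at the [size p] points 0,
   -1, -2, ... by [sum_rstirling2_ffact]. *)
apply: (@roots_geq_poly_eq0 _ _ [seq - (x%:R : rat) | x <- iota 0 (size p)]).
- apply/allP => _ /mapP[x _ ->]; apply/rootP.
  rewrite hornerD hornerN horner_sum hornerZ hornerM hornerXn horner_rising_polyN.
  rewrite (eq_bigr (fun j : 'I_ _ => (rstirling2 r (r + d) j * x ^_ j)%:R)).
    rewrite -natr_sum sum_rstirling2_ffact natrM natrX -[- x%:R]mulN1r.
    rewrite exprMn exprD -!mulrA [X in _ - X](_ : _ =
      ((-1) ^+ r * (-1) ^+ r) * ((-1) ^+ d * (-1) ^+ d)
      * ((x ^_ r)%:R * x%:R ^+ d)); last by ring.
    by rewrite -!expr2 !sqrr_sign !mul1r subrr.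
  by move=> j _; rewrite hornerZ horner_rising_polyN natrM -mulrA signrMK.
- rewrite map_inj_uniq ?iota_uniq // => x y /oppr_inj /eqP.
  by rewrite eqr_nat => /eqP.
- by rewrite size_map size_iota.
Qed.

(** * Powers of [- log (1 + x)] *)

Lemma coef_exp_poly (g : nat -> rat) N m n : (n < N)%N ->
  ((\poly_(i < N) g i) ^+ m)`_n = fps_exp g m n.
Proof.
elim: m n => [|m IHm] n lt_nN; first by rewrite expr0 coef1.
rewrite exprS coefM; apply: eq_bigr => i _.
have le_in : (i <= n)%N by rewrite -ltnS.
rewrite coef_poly (leq_ltn_trans le_in lt_nN) IHm //.
exact: leq_ltn_trans (leq_subr _ _) lt_nN.
Qed.

(* Coefficientwise, [(1 + x) y' = - (m + 1) (- log (1 + x))^m] for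
   [y = (- log (1 + x))^(m + 1)]. *)
Lemma fps_exp_log1p_rec m n :
  let e := fps_exp (fun i => - fps_log1p i) in
  n.+1%:R * e m.+1 n.+1 + n%:R * e m.+1 n = - (m.+1%:R * e m n).
Proof.
(* Truncating to a polynomial gives access to formal derivatives; the coefficient of [x ^ n] in a
   derivative involves that of [x ^ n.+1], hence [n.+2] terms. *)
move=> e; pose N := n.+2.
pose P : {poly rat} := \poly_(i < N) (- fps_log1p i).
have ode i : (i <= n)%N -> ((1 + 'X) * P^`())`_i = - (i == 0%N)%:R.
  move=> le_in; have dP l : (l <= n)%N -> P^`()`_l = - (-1) ^+ l.
    move=> le_ln; rewrite coef_deriv coef_poly ltnS ltnS le_ln /=.
    by rewrite mulNrn -(mulr_natr (_ / _)) divfK // pnatr_eq0.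
  rewrite mulrDl mul1r coefD coefXM dP //; case: i le_in => [|i] lt_in /=.
    by rewrite addr0 expr0.
  by rewrite dP ?(ltnW lt_in) // exprS mulN1r opprK subrr oppr0.
have dE : ((1 + 'X) * (P ^+ m.+1)^`())`_n = - (m.+1%:R * e m n).
  rewrite deriv_exp /= mulrnAr coefMn mulrA coefM big_ord_recl /= ode // subn0.
  rewrite big1 ?addr0 => [|i _].
    by rewrite mulN1r coef_exp_poly // mulr_natl mulNrn.
  by rewrite ode ?oppr0 ?mul0r //= ltn_ord.
rewrite -dE mulrDl mul1r coefD coefXM; congr (_ + _).
  by rewrite coef_deriv coef_exp_poly // mulr_natl.
case: n @N @P {ode dE} => [|n] N P; first by rewrite mul0r.
by rewrite coef_deriv /= coef_exp_poly ?mulr_natl.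
Qed.

(** Multiplied by [n!], the recurrence [fps_exp_log1p_rec] turns into [coef_rising_polyS], the sign
    and [m!] absorbing its factor [- (m + 1)]. *)
Lemma fps_exp_log1p m n :
  n`!%:R * fps_exp (fun i => - fps_log1p i) m n
  = (-1) ^+ n * m`!%:R * (rising_poly n)`_m.
Proof.
set e := fps_exp _; elim: n m => [|n IHn] m.
  rewrite /rising_poly big_ord0 coef1 expr0 !mul1r.
  case: m => [|m] //; rewrite mulr0 /e /=.
  by rewrite /fps_mul big_ord1 /= oppr0 mul0r.
case: m => [|m]; first by rewrite coef0_rising_polyS !mulr0.
have rec := fps_exp_log1p_rec m n; rewrite -/e in rec.
rewrite factS mulnC natrM -mulrA.
have -> : n.+1%:R * e m.+1 n.+1 = - (m.+1%:R * e m n) - n%:R * e m.+1 n.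
  by rewrite -rec addrK.
rewrite mulrBr mulrN !(mulrCA n`!%:R) !IHn coef_rising_polyS factS natrM exprS.
ring.
Qed.

(** The coefficients of [rising_poly j] vanish past degree [j], so the bound [N] can be common to
    all [j], which permits exchanging the sums later. *)
Lemma polyCauchy2E k j N : (j < N)%N ->
  polyCauchy2 k j =
  (-1) ^+ j * \sum_(m < N) (rising_poly j)`_m / (m + 1)%:R ^ k.
Proof.
move=> lt_jN; rewrite /polyCauchy2 /fps_comp !mulr_sumr.
rewrite (big_ord_widen N (fun m => j`!%:R * (fps_Lif k m * fps_exp _ m j))) //.
rewrite big_mkcond; apply: eq_bigr => m _; rewrite ltnS.
case: leqP => [_|lt_jm]; last by rewrite coef_rising_poly_gt // mul0r mulr0.
have m0 : m`!%:R != 0 :> rat by rewrite pnatr_eq0 -lt0n fact_gt0.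
rewrite mulrCA fps_exp_log1p /fps_Lif; field.
by rewrite m0 andbT expfz_neq0 // addn1 pnatr_eq0.
Qed.

Theorem theorem3 (n r : nat) (k : int) (r_gt0 : (1 <= r)%N) (le_rn : (r <= n)%N) :
  \sum_(r <= j < n.+1) (rstirling2 r n j)%:R * polyCauchy2 k j =
  \sum_(1 <= l < r.+1)
     (-1) ^+ n / (n - r + l + 1)%:R ^ k * (stirling1 r l)%:R :> rat.
Proof.
have [d ->] : exists d, n = (r + d)%N by exists (n - r)%N; rewrite subnKC.
rewrite addKn.
transitivity (\sum_(m < (r + d).+1)
    ((-1) ^+ (r + d) *: (rising_poly r * 'X^d))`_m / (m + 1)%:R ^ k).
  rewrite -sum_rstirling2_rising_poly.
  transitivity (\sum_(j < (r + d).+1) (rstirling2 r (r + d) j)%:R * polyCauchy2 k j).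
    rewrite -(big_mkord xpredT (fun j =>
      (rstirling2 r (r + d) j)%:R * polyCauchy2 k j)).
    (* Starting at 0 only adds the terms [j < r], which are zero. *)
    rewrite [RHS](big_cat_nat (leq0n r)) ?leqW ?leq_addr //=.
    rewrite [X in X + _]big_nat_cond [X in X + _]big1 ?add0r // =>
      j /andP[/andP[_ lt_jr] _].
    by rewrite rstirling2_lt // mul0r.
  under eq_bigr => j _ do rewrite (polyCauchy2E _ (ltn_ord j)) mulrA mulr_sumr.
  rewrite exchange_big; apply: eq_bigr => m _ /=.
  rewrite coef_sum mulr_suml; apply: eq_bigr => j _.
  by rewrite coefZ mulrA.
rewrite -(big_mkord xpredT (fun m =>
  ((-1) ^+ (r + d) *: (rising_poly r * 'X^d))`_m / (m + 1)%:R ^ k)).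
(* The factor ['X^d] kills the coefficients below [d]; the others are reindexed by [m = l + d]. *)
rewrite (big_cat_nat (leq0n d)) ?leqW ?leq_addl //=.
rewrite [X in X + _]big_nat_cond [X in X + _]big1 ?add0r => [|m /andP[/andP[_ lt_md] _]].
  rewrite -{1}[d]add0n big_addn subSn ?leq_addl // addnK big_ltn //.
  (* For [r >= 1], [rising_poly r] has no constant term, so the term [l = 0] disappears. *)
  rewrite coefZ coefMXn ltnNge leq_addl addnK -{2}(prednK r_gt0).
  rewrite coef0_rising_polyS mulr0 mul0r add0r; apply: eq_bigr => l _.
  rewrite coefZ coefMXn ltnNge leq_addl addnK coef_rising_poly (addnC l).
  by rewrite mulrAC.
by rewrite coefZ coefMXn lt_md mulr0 mul0r.
Qed.
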